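(* If $q\in(1,q_3)\setminus\left\{\frac{1+\sqrt5}{2}\right\}$, then $1$ has $2^{\aleph_0}$ different $q$-expansions.
   Context: For $q\in(1,2)$, a $q$-expansion of a real number $x\in[0,\frac{1}{q-1}]$ is a sequence $(\delta_i)_{i=1}^\infty\in\{0,1\}^{\mathbb{N}}$ with $x=\sum_{i=1}^\infty \delta_i q^{-i}$. The number $q_3\approx1.68042$ is the unique root of $x^5-x^4-x^3-x+1=0$ in $(1,2)$. *)

(* Defs.v *)
From HB Require Import structures.
From mathcomp Require Import all_boot all_order all_algebra.
From mathcomp Require Import all_classical all_reals all_analysis.
From mathcomp Require Import ring lra.

Set Implicit Arguments.
Unset Strict Implicit.
Unset Printing Implicit Defensive.

Import Order.TTheory GRing.Theory Num.Theory.
Import numFieldNormedType.Exports.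

Local Open Scope classical_set_scope.
Local Open Scope ring_scope.

(* The digit sequence (delta_i)_{i >= 1} is indexed from 0: d i is the digit
   delta_{i+1}, so it carries the weight q^-(i+1). *)
Definition q_expansion (R : realType) (q x : R) (d : nat -> bool) : Prop :=
  series (fun i => (d i)%:R * q ^- i.+1) @ \oo --> x.

Definition golden_ratio (R : realType) : R := (1 + Num.sqrt 5) / 2.

Definition q3_roots (R : realType) : set R :=
  [set x : R | 1 < x < 2 /\ x ^+ 5 - x ^+ 4 - x ^+ 3 - x + 1 = 0].

(* The default value 0 of xget is irrelevant, by q3_rootsE. *)
Definition q3 (R : realType) : R := xget 0 (@q3_roots R).

Lemma q3_roots_nonempty (R : realType) : exists x : R, q3_roots x.
Proof.
pose p : {poly R} := 'X^5 - 'X^4 - 'X^3 - 'X + 1.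
have pE x : p.[x] = x ^+ 5 - x ^+ 4 - x ^+ 3 - x + 1 by rewrite /p !hornerE.
have [||x /andP[x1 x2]] := @poly_ivt R p 1 2; first by rewrite ler1n.
  by rewrite !pE; apply/andP; split; lra.
rewrite /root pE => /eqP px; exists x; split => //.
apply/andP; split; rewrite lt_neqAle.
- by rewrite x1 andbT; apply/eqP => xE; move: px; rewrite -xE; lra.
- by rewrite x2 andbT; apply/eqP => xE; move: px; rewrite xE; lra.
Qed.

Lemma q3_roots_inj (R : realType) (x y : R) :
  q3_roots x -> q3_roots y -> x = y.
Proof.
have lt_absurd (u v : R) : q3_roots u -> q3_roots v -> u < v -> False.
  move=> [/andP[u1 _] pu] [/andP[v1 _] pv] uv.
  pose a := u - 1; pose b := v - 1.
  have a0 : 0 < a by rewrite subr_gt0.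
  have ab : a < b by rewrite ltrD2r.
  have b0 : 0 < b := lt_trans a0 ab.
  pose g (t : R) := t + 5 * t ^+ 2 + 4 * t ^+ 3 + t ^+ 4.
  have ga : a * g a = 1 + 3 * a.
    by apply/eqP; rewrite -subr_eq0 -pu /g /a; apply/eqP; ring.
  have gb : b * g b = 1 + 3 * b.
    by apply/eqP; rewrite -subr_eq0 -pv /g /b; apply/eqP; ring.
  have gab : g a <= g b.
    have le_exp n : a ^+ n <= b ^+ n by rewrite lerXn2r ?nnegrE ?ltW.
    have := (le_exp 2, le_exp 3, le_exp 4); rewrite /g => -[[? ?] ?]; lra.
  have : 0 <= a * b * (g b - g a).
    by apply: mulr_ge0; [apply: mulr_ge0; exact: ltW | rewrite subr_ge0].
  have -> : a * b * (g b - g a) = a * (b * g b) - b * (a * g a) by ring.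
  rewrite ga gb; lra.
move=> rx ry; have [xy|yx|//] := ltgtP x y.
- by case: (lt_absurd _ _ rx ry xy).
- by case: (lt_absurd _ _ ry rx yx).
Qed.

Lemma q3_rootsE (R : realType) : @q3_roots R = [set q3 R].
Proof.
have q3P : q3_roots (q3 R) by apply: xgetPex; exact: q3_roots_nonempty.
apply/seteqP; split => [x rx|x ->//]; exact: q3_roots_inj.
Qed.

(* Main.v *)
Require Import Defs.
From HB Require Import structures.
From mathcomp Require Import all_boot all_order all_algebra.
From mathcomp Require Import all_classical all_reals all_analysis.
From mathcomp Require Import ring lra zify.

Import Order.TTheory GRing.Theory Num.Theory.
Import numFieldNormedType.Exports.

Local Open Scope classical_set_scope.
Local Open Scope ring_scope.
Local Open Scope card_scope.

(* Expansions of x correspond to infinite orbits of x under the maps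
   y |-> q y and y |-> q y - 1 inside I = [0, 1/(q-1)].  If every point of a
   bounded set A containing 1 can reach, inside A, a point both of whose images
   lie in A, then 1 has continuum many expansions.

   Below the golden ratio, the interior of I is such a set.  Above it, the
   points of I that never reach a point with both images in I are the end
   points and the preimages of the 2-cycle {b, q b}, b = 1/(q^2-1).  Take for A
   the points of Z[q] that do reach such a point.  If A fails, there is a point
   all of whose branchings lose one side to these exceptional points; following
   the other side gives an infinite chain of points 1 + p b (up to the symmetry
   x |-> 1/(q-1) - x of I) with p = 0 or p = q^-k, and each link of the chain is
   an equation for q.  For q < q3 such a chain exists only for two algebraic
   numbers q, whose minimal polynomials m are sextics.  But it also forces
   b to be in Z[q], that is, (q^2 - 1) P(q) = 1 with P integral, so m(1) would
   divide 1, whereas m(1) is -5 or -3. *)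

(** * Digit streams from branching orbits *)

Definition step {R : realType} (q : R) (c : bool) (x : R) : R := q * x - c%:R.

Fixpoint branches {R : realType} (q : R) (A : set R) (n : nat) (x : R) : Prop :=
  match n with
  | 0 => A (step q false x) /\ A (step q true x)
  | n.+1 => exists2 c, A (step q c x) & branches q A n (step q c x)
  end.

Definition branching {R : realType} (q : R) (A : set R) (x : R) : Prop :=
  exists n, branches q A n x.

Section Continuum.
Context {R : realType} (q : R) (A : set R) (M : R).
Hypothesis q1 : 1 < q.
Hypothesis A_bounded : forall x, A x -> `|x| <= M.
Hypothesis A_branching : forall x, A x -> branching q A x.

(** Distance to the nearest branching point; the default 0 never matters, as every point of [A]
    reaches one. *)
Let rank (x : R) : nat :=
  if pselect (exists n, `[< branches q A n x >]) is left h then ex_minn h else 0.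

Let rankP x : A x ->
  branches q A (rank x) x /\ forall n, branches q A n x -> (rank x <= n)%N.
Proof.
move=> /A_branching[n xn]; rewrite /rank; case: pselect => [h|[]]; last first.
  by exists n; apply/asboolP.
case: ex_minnP => m /asboolP xm mmin; split => // k xk.
by apply: mmin; apply/asboolP.
Qed.

Let pick (x : R) : bool :=
  xget false [set c | A (step q c x) /\ branches q A (rank x).-1 (step q c x)].

Let pickP x : A x -> ~ branches q A 0 x ->
  A (step q (pick x) x) /\ (rank (step q (pick x) x) < rank x)%N.
Proof.
move=> Ax nb; have [xr _] := rankP x Ax.
have : [set c | A (step q c x) /\ branches q A (rank x).-1 (step q c x)] (pick x).
  apply: (@xgetPex _ false).
  by case: (rank x) xr => [//|r /= [c Ac bc]]; exists c.
move=> -[Ac bc]; split => //.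
have [_ /(_ _ bc)] := rankP _ Ac.
by move=> le; apply: leq_ltn_trans le _; case: (rank x) xr => [//|].
Qed.

Variables (x0 : R) (Ax0 : A x0).

(* At a branching point the digit is read off the free sequence s; elsewhere it
   follows a shortest path to a branching point. *)
Let digit (s : nat -> bool) (p : R * nat) : bool :=
  if `[< branches q A 0 p.1 >] then s p.2 else pick p.1.

(** The second component counts the entries of [s] already used. *)
Let next (s : nat -> bool) (p : R * nat) : R * nat :=
  (step q (digit s p) p.1, if `[< branches q A 0 p.1 >] then p.2.+1 else p.2).

Let state s n := iter n (next s) (x0, 0%N).
Let digits s n := digit s (state s n).

Let state_in s n : A (state s n).1.
Proof.
elim: n => [//|n IH]; rewrite /state iterS -/(state s n) /next /digit /=.
case: asboolP => [[b0 b1]|nb]; first by case: (s _).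
by have [] := pickP _ IH nb.
Qed.

(** Telescoping the steps leaves a remainder [q ^- n] times the current orbit point, which vanishes
    in the limit on a bounded orbit. *)
Let partial_sum s n :
  series (fun i => (digits s i)%:R * q ^- i.+1) n = x0 - q ^- n * (state s n).1.
Proof.
have q0 : q != 0 by rewrite gt_eqF // (lt_trans ltr01).
elim: n => [|n IH]; first by rewrite /series /= big_geq // expr0 invr1 mul1r subrr.
have -> : (state s n.+1).1 = q * (state s n).1 - (digits s n)%:R by [].
rewrite seriesSr IH exprS; have := expf_neq0 n q0; move: (q ^+ n) => z z0.
by field; rewrite z0 q0.
Qed.

Let digits_expansion s : q_expansion q x0 (digits s).
Proof.
have q0 : 0 < q by rewrite (lt_trans ltr01).
rewrite /q_expansion (funext (partial_sum s)).
rewrite -[X in _ --> X]subr0; apply: cvgB; first exact: cvg_cst.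
have cv : geometric M q^-1 @ \oo --> 0.
  by apply: cvg_geometric; rewrite ger0_norm ?invr_ge0 ?invf_lt1 // ltW.
apply/norm_cvg0P; apply: (squeeze_cvgr _ (cvg_cst 0) cv).
apply: nearW => n; have qn0 : 0 <= q ^- n by rewrite invr_ge0 exprn_ge0 // ltW.
rewrite normr_ge0 /= normrM (ger0_norm qn0) mulrC exprVn.
by apply: ler_wpM2r => //; exact: A_bounded.
Qed.

(** Equal digits give equal states, so both runs use their free entries at the same times. The rank
    drops between branchings, so every entry is eventually used. *)
Let digits_inj s s' : digits s = digits s' -> s = s'.
Proof.
move=> e; have st n : state s n = state s' n.
  elim: n => [//|n IH]; rewrite /state !iterS -/(state s n) -/(state s' n).
  have := congr1 (@^~ n) e; rewrite /digits /= => dn.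
  by rewrite /next dn IH.
have reach k : exists2 n, (state s n).2 = k & branches q A 0 (state s n).1.
  have to_branch m : exists2 n, (state s n).2 = (state s m).2 &
      branches q A 0 (state s n).1.
    have [r] := ubnP (rank (state s m).1); elim: r m => [//|r IH] m.
    rewrite ltnS => le.
    have [b|nb] := pselect (branches q A 0 (state s m).1); first by exists m.
    have [Ac lt] := pickP _ (state_in s m) nb.
    have E : state s m.+1 = (step q (pick (state s m).1) (state s m).1, (state s m).2).
      rewrite {1}/state iterS -/(state s m) /next /digit.
      by case: asboolP.
    have [|n nE bn] := IH m.+1; first by rewrite E; exact: leq_trans le.
    by exists n => //; rewrite nE E.
  elim: k => [|k [n nk bn]]; first exact: (to_branch 0).
  have [n' n'E bn'] := to_branch n.+1; exists n' => //.
  by rewrite n'E /state iterS -/(state s n) /next /= nk; case: asboolP.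
apply/funext => k; have [n nk bn] := reach k.
have := congr1 (@^~ n) e; rewrite /digits /digit /= -st nk.
by case: asboolP.
Qed.

Lemma branching_continuum :
  [set d : nat -> bool | q_expansion q x0 d] #= [set: nat -> bool].
Proof.
rewrite card_eq_le; apply/andP; split; first exact: subset_card_le.
apply: card_le_trans (subset_card_le (_ : range digits `<=` _)).
  have inj : {in setT &, injective digits} := in2W digits_inj.
  by have /card_eqPle[_] := inj_card_eq inj.
by move=> _ [s _ <-]; exact: digits_expansion.
Qed.
End Continuum.

(** * Chains of weights *)

(* The weight 0 stands for an end point of the interval, q^-k for a point that
   enters the 2-cycle after k steps. *)
Definition weight {R : realType} (q p : R) : Prop :=
  p = 0 \/ exists k, p = q ^- k.+1.

Lemma ler_expV {R : realType} (q : R) (m n : nat) :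
  1 < q -> (q ^- m <= q ^- n) = (n <= m)%N.
Proof.
move=> q1; have q0 : 0 < q by lra.
by rewrite lef_pV2 ?posrE ?exprn_gt0 // ler_eXn2l.
Qed.

Lemma ltr_expV {R : realType} (q : R) (m n : nat) :
  1 < q -> (q ^- m < q ^- n) = (n < m)%N.
Proof.
move=> q1; have q0 : 0 < q by lra.
by rewrite ltf_pV2 ?posrE ?exprn_gt0 // ltr_eXn2l.
Qed.

Lemma weight_ge0 {R : realType} (q p : R) : 1 < q -> weight q p -> 0 <= p.
Proof.
by move=> q1 [->//|[k ->]]; rewrite invr_ge0 exprn_ge0 //; lra.
Qed.

Lemma weight_le {R : realType} (q p : R) : 1 < q -> weight q p -> p <= q^-1.
Proof.
move=> q1 [->|[k ->]]; first by rewrite invr_ge0; lra.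
by rewrite -[q in leRHS]expr1 ler_expV.
Qed.

Lemma weight_gap {R : realType} (q p : R) (n : nat) :
  1 < q -> weight q p -> q ^- n.+1 < p -> q ^- n <= p.
Proof.
move=> q1 [->|[k ->]]; last by rewrite ltr_expV // ler_expV.
by rewrite ltNge invr_ge0 exprn_ge0 //; lra.
Qed.

(** Quotients of nonzero weights are integral powers of [q], and none lies strictly between [q ^+ 2]
    and [q ^+ 3]. *)
Lemma weight_gapM {R : realType} (q p p' : R) : 1 < q ->
  weight q p -> weight q p' -> 0 < p -> q ^+ 2 * p < p' -> q ^+ 3 * p <= p'.
Proof.
move=> q1; have q0 : 0 < q by lra.
case=> [->|[k ->]]; first by rewrite ltxx.
case=> [->|[j ->]] _.
  by rewrite ltNge divr_ge0 ?exprn_ge0 // ltW.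
rewrite ltr_pdivrMr ?exprn_gt0 // mulrC ltr_pdivlMr ?exprn_gt0 //.
rewrite ler_pdivrMr ?exprn_gt0 // [leRHS]mulrC ler_pdivlMr ?exprn_gt0 //.
by rewrite -!exprD ltr_eXn2l // ler_eXn2l.
Qed.

Lemma weight_cases {R : realType} (q p : R) : 1 < q -> weight q p ->
  [\/ p = 0, p = q^-1, p = q ^- 2 | 0 < p <= q ^- 3].
Proof.
move=> q1 [->|[[|[|k]] ->]]; [exact: Or41|exact: Or42|exact: Or43|apply: Or44].
by rewrite ler_expV // invr_gt0 exprn_gt0 //; lra.
Qed.

(* f > 0 means that q exceeds the golden ratio, q^3 f < q - 1 that q < q3. *)
Record base_data {R : realType} (q f g u : R) : Prop := BaseData {
  base_f : f = q ^+ 2 - q - 1;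
  base_g : g = f * (q ^+ 2 - 1);
  base_u : u = q^-1;
  base_gt1 : 1 < q;
  base_f_gt0 : 0 < f;
  base_f_lt : q ^+ 3 * f < q - 1 }.

Lemma base_u_bounds {R : realType} (q f g u : R) : base_data q f g u ->
  [/\ 0 < q, q * u = 1, 0 < u & u < 1].
Proof.
case=> fE gE uE q1 f0 fub; have q0 : 0 < q by lra.
by split; rewrite // uE ?divff ?invr_gt0 ?invf_lt1 // gt_eqF.
Qed.

Lemma base_bounds {R : realType} (q f g u : R) : base_data q f g u ->
  [/\ 8 / 5 < q, q < 17 / 10, q ^+ 2 * f < 1 - u, (q + 1) * q * f < 1
    & q ^+ 2 * g < 1 - u ^+ 3].
Proof.
move=> bd; have [q0 qu u0 u1] := base_u_bounds _ _ _ _ bd.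
case: bd => fE gE uE q1 f0 fub.
have q3lb : 8 / 5 < q.
  by rewrite ltNge; apply/negP => h; move: f0; rewrite fE; nra.
have qub : q < 17 / 10.
  rewrite ltNge; apply/negP => h.
  have hf : 19/100 <= f by rewrite fE; nra.
  have h3 : 289/100 <= q ^+ 2 by nra.
  have h4 : 289/100 * q <= q ^+ 3 by rewrite exprSr ler_pM2r.
  nra.
have fub1 : q ^+ 2 * f < 1 - u.
  by rewrite -(ltr_pM2l q0) mulrBr mulr1 qu; move: fub; lra.
have fub2 : (q + 1) * q * f < 1.
  have : (q + 1) * (q ^+ 3 * f) < (q + 1) * (q - 1) by rewrite ltr_pM2l //; lra.
  have := exprn_gt0 2 q0 => q20.
  move=> h; rewrite -(ltr_pM2l q20); nra.
split=> //.
have : (q ^+ 2 - 1) * (q ^+ 3 * f) < (q ^+ 2 - 1) * (q - 1).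
  by rewrite ltr_pM2l //; nra.
move=> h.
(* The left side is [q ^+ 2 * (q ^+ 2 - 1) * (q - 1) - (q ^+ 3 - 1)], which turns the bound on
   [q ^+ 3 * f] into the one on [q ^+ 2 * g]. *)
have : (q - 1) * (q ^+ 4 - 2 * q ^+ 2 - q - 1) < 0.
  rewrite pmulr_rlt0; last lra.
  have -> : q ^+ 4 - 2 * q ^+ 2 - q - 1 = (q + 1) * q * f - 1 by rewrite fE; ring.
  lra.
move=> h2.
rewrite -(ltr_pM2l (exprn_gt0 3 q0)) mulrBr mulr1 -exprMn qu expr1n.
have -> : q ^+ 3 * (q ^+ 2 * g) = q ^+ 2 * ((q ^+ 2 - 1) * (q ^+ 3 * f)).
  by rewrite gE; ring.
have h3 : q ^+ 2 * ((q ^+ 2 - 1) * (q ^+ 3 * f)) < q ^+ 2 * ((q ^+ 2 - 1) * (q - 1)).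
  by rewrite ltr_pM2l // exprn_gt0.
nra.
Qed.

(** Both [p'] and [q ^+ 2 * p] are 0 or powers of [u], and their sum [1 - q ^+ 2 * f] exceeds [u].
    Since [u ^+ 2 + u ^+ 3 < u], one of them is [u] or both are [u ^+ 2]. *)
Lemma split_target {R : realType} (q f g u p p' : R) : base_data q f g u ->
  weight q p -> p <= u ^+ 3 -> weight q p' -> p' = 1 - q ^+ 2 * f - q ^+ 2 * p ->
  [\/ p = u ^+ 3 /\ p' = 1 - q ^+ 2 * f - u,
      p' = u /\ q ^+ 2 * p = 1 - q ^+ 2 * f - u
    | [/\ p = u ^+ 4, p' = u ^+ 2 & 1 - q ^+ 2 * f = 2 * u ^+ 2]].
Proof.
move=> bd; have [q0 qu u0 u1] := base_u_bounds _ _ _ _ bd.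
have [qlb qub fub1 _ _] := base_bounds _ _ _ _ bd.
case: bd => fE gE uE q1 f0 fub wp pu wp' p'E.
have unE n : q ^- n = u ^+ n by rewrite uE exprVn.
have q2u n : q ^+ 2 * u ^+ n.+2 = u ^+ n.
  by rewrite -[n.+2]addn2 [(n + 2)%N]addnC exprD mulrA -exprMn qu expr1n mul1r.
have q20 := exprn_gt0 2 q0.
have u20 := exprn_gt0 2 u0.
have u30 := exprn_gt0 3 u0.
have uu : u ^+ 2 + u ^+ 3 < u.
  have -> : u ^+ 2 + u ^+ 3 = u - u ^+ 3 * f by rewrite fE uE; field; lra.
  by rewrite gtrBl mulr_gt0.
have [p'u|p'u] := eqVneq p' u; first by apply: Or32; split => //; lra.
have p'2 : p' <= u ^+ 2.
  case/(weight_cases _ _ q1): wp' p'u => [->|->|->|/andP[_]]; rewrite ?unE.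
  - by move=> _; exact: ltW.
  - by rewrite uE eqxx.
  - by [].
  - by move=> /le_trans le _; apply: le; rewrite ler_wiXn2l // ltW.
have [pu3|pu3] := eqVneq p (u ^+ 3).
  by apply: Or31; split => //; move: p'E; rewrite pu3 q2u expr1.
have p4 : p <= u ^+ 4.
  rewrite leNgt; apply/negP => lt.
  have := weight_gap q p 3 q1 wp; rewrite !unE => /(_ lt) le.
  by move: pu3; rewrite eq_le pu le.
have [pu4|pu4] := eqVneq p (u ^+ 4).
  have [p'u2|p'u2] := eqVneq p' (u ^+ 2).
    by apply: Or33; split => //; move: p'E; rewrite pu4 p'u2 q2u; lra.
  have p'3 : p' <= u ^+ 3.
    rewrite leNgt; apply/negP => lt.
    have := weight_gap q p' 2 q1 wp'; rewrite !unE => /(_ lt) le.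
    by move: p'u2; rewrite eq_le p'2 le.
  by move: p'E; rewrite pu4 q2u; lra.
have p5 : p <= u ^+ 5.
  rewrite leNgt; apply/negP => lt.
  have := weight_gap q p 4 q1 wp; rewrite !unE => /(_ lt) le.
  by move: pu4; rewrite eq_le p4 le.
have : q ^+ 2 * p <= u ^+ 3 by rewrite -q2u ler_pM2l.
lra.
Qed.

(* St p stands for: 1 + p b is a point all of whose branchings lose one side.
   Each clause comes from the next branching point on the orbit of 1 + p b; its
   two alternatives tell which of the two images is the exceptional one. *)
Record chain_data {R : realType} (q f g u : R) (St : R -> Prop) : Prop :=
  ChainData {
  chain_weight : forall p, St p -> weight q p;
  chain_small : forall p, St p -> p <= u ^+ 3 -> exists2 p', St p' &
    p' = q ^+ 2 * p + g \/ p' = 1 - q ^+ 2 * f - q ^+ 2 * p;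
  chain_u : St u -> exists2 p', St p' & p' = q ^+ 2 * g - f \/ p' = 1 - q ^+ 2 * g;
  chain_u2 : St (u ^+ 2) -> exists2 p', St p' & p' = q * g - f \/ p' = 1 - q * g }.

(** * Exclusion of all chains away from the two sextics *)

Section Excluded.
Context {R : realType} (q f g u : R) (St : R -> Prop).
Hypothesis bd : base_data q f g u.
Hypothesis cd : chain_data q f g u St.
(* At a root of the first sextic the chain can be constant at the weight q^-3, at
   a root of the second one at the weight q^-1. *)
Hypothesis neq1 : q ^+ 6 - q ^+ 4 - q ^+ 3 - 2 * q ^+ 2 - q - 1 != 0.
Hypothesis neq2 : q ^+ 6 - 2 * q ^+ 4 - q ^+ 3 - 1 != 0.

Lemma gap_absurd p n : weight q p -> u ^+ n.+1 < p -> p < u ^+ n -> False.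
Proof.
case: bd => _ _ uE q1 _ _ wp; have := weight_gap q p n q1 wp.
by rewrite -!exprVn -uE => h /h; rewrite leNgt => /negP.
Qed.

(** The bound [q ^+ 2 * g < 1 - u ^+ 3] leaves only the weights [u] and [u ^+ 2], and [u] would make
    [q] a root of the second sextic. *)
Lemma one_sub_q2g p : weight q p -> p = 1 - q ^+ 2 * g ->
  p = u ^+ 2 /\ f = u ^+ 4.
Proof.
move=> wp pE; have [q0 qu u0 u1] := base_u_bounds _ _ _ _ bd.
have [qlb qub fub1 _ qqg] := base_bounds _ _ _ _ bd.
case: bd => fE gE uE q1 f0 fub.
have unE n : q ^- n = u ^+ n by rewrite uE exprVn.
have u30 := exprn_gt0 3 u0.
have q4 : q ^+ 4 * (q ^+ 2 - 1) != 0.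
  by rewrite mulf_neq0 ?expf_neq0 // ?gt_eqF //; nra.
case/(weight_cases _ _ q1): wp pE => [->|->|->|/andP[_]]; rewrite ?unE; [lra| | |lra].
- move=> E; exfalso; move: neq2 => /eqP; apply.
  have : q * (1 - q ^+ 2 * g - q^-1) = 0 by rewrite -E subrr mulr0.
  rewrite mulrBr divff ?gt_eqF // gE => /eqP h.
  have : (q - 1) * (q ^+ 6 - 2 * q ^+ 4 - q ^+ 3 - 1) = 0.
    by apply/eqP; rewrite -oppr_eq0 -(eqP h) fE; apply/eqP; ring.
  by move/eqP; rewrite mulf_eq0 => /orP[|/eqP//]; rewrite subr_eq0 gt_eqF.
- move=> E; split => //; apply: (mulfI q4).
  have -> : q ^+ 4 * (q ^+ 2 - 1) * u ^+ 4 = q ^+ 2 - 1.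
    by rewrite mulrAC -exprMn qu expr1n mul1r.
  have : q ^+ 2 * u ^+ 2 = q ^+ 2 * (1 - q ^+ 2 * g) by rewrite E.
  by rewrite -exprMn qu expr1n gE => h; lra.
Qed.

(** The candidates for the next weight become [u - u ^+ 3 - u ^+ 4], strictly between [u ^+ 3] and
    [u ^+ 2], and [1 - u + u ^+ 3], above the largest weight [u]. *)
Lemma chain_u2_f_absurd : St (u ^+ 2) -> f = u ^+ 4 -> False.
Proof.
move=> st fu; have [q0 qu u0 u1] := base_u_bounds _ _ _ _ bd.
have [qlb qub fub1 _ qqg] := base_bounds _ _ _ _ bd.
have [p' st'] := chain_u2 _ _ _ _ _ cd st.
have wp' := chain_weight _ _ _ _ _ cd _ st'.
case: bd => fE gE uE q1 f0 fub.
have qgE : q * g = u - u ^+ 3 by rewrite gE fu uE; field; lra.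
have E1 : u ^+ 2 = 1 - u - u ^+ 6.
  apply/eqP; rewrite -subr_eq0; apply/eqP.
  have -> : u ^+ 6 = u ^+ 2 * f by rewrite fu; ring.
  by rewrite fE uE; field; lra.
have u2 : u < 5 / 8 by rewrite uE -[ltRHS]invf_div ltf_pV2 ?posrE.
have u5 : 10 / 17 < u by rewrite uE -[ltLHS]invf_div ltf_pV2 ?posrE.
have u30 := exprn_gt0 3 u0.
have u40 := exprn_gt0 4 u0.
have u60 := exprn_gt0 6 u0.
case=> p'E.
- have {}p'E : p' = u - u ^+ 3 - u ^+ 4 by rewrite p'E qgE fu.
  apply: (gap_absurd _ 2 wp'); rewrite p'E; nra.
- have {}p'E : p' = 1 - u + u ^+ 3 by rewrite p'E qgE; lra.
  have := weight_le _ _ q1 wp'; rewrite -uE p'E.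
  have -> : 1 - u + u ^+ 3 = u + (1 - u) * (1 - u - u ^+ 2) by ring.
  have -> : 1 - u - u ^+ 2 = u ^+ 6 by lra.
  by rewrite gerDl leNgt mulr_gt0 // subr_gt0.
Qed.

(** Here [p' < u ^+ 2], and [p' = u ^+ 3] is the first sextic, so [p' <= u ^+ 4]; one more link then
    gives a contradiction. *)
Lemma chain_u3_absurd p' : St (u ^+ 3) -> St p' -> p' = 1 - q ^+ 2 * f - u -> False.
Proof.
move=> st st' p'E; have [q0 qu u0 u1] := base_u_bounds _ _ _ _ bd.
have [qlb qub fub1 _ qqg] := base_bounds _ _ _ _ bd.
have wp' := chain_weight _ _ _ _ _ cd _ st'.
have [fE gE uE q1 f0 fub] := bd.
have u20 := exprn_gt0 2 u0.
have p'2 : p' < u ^+ 2.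
  have -> : u ^+ 2 = 1 - u - u ^+ 2 * f by rewrite fE uE; field; lra.
  have : u ^+ 2 * f < q ^+ 2 * f by rewrite ltr_pM2r // ltrXn2r //; lra.
  lra.
have unE n : q ^- n = u ^+ n by rewrite uE exprVn.
have p'3 : p' <= u ^+ 3.
  by rewrite leNgt; apply/negP => lt; apply: (gap_absurd p' 2).
have [p'u3|p'u3] := eqVneq p' (u ^+ 3).
  move: neq1 => /eqP; apply.
  have : q ^+ 3 * (1 - q ^+ 2 * f - q^-1 - q^-1 ^+ 3) = 0.
    by rewrite -uE -p'E p'u3 subrr mulr0.
  move=> h; have : (q - 1) * (q ^+ 6 - q ^+ 4 - q ^+ 3 - 2 * q ^+ 2 - q - 1) = 0.
    by apply/eqP; rewrite -oppr_eq0 -h fE; apply/eqP; field; lra.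
  by move/eqP; rewrite mulf_eq0 => /orP[|/eqP//]; rewrite subr_eq0 gt_eqF.
have p'4 : p' <= u ^+ 4.
  rewrite leNgt; apply/negP => lt; apply: (gap_absurd p' 3) => //.
  by rewrite lt_neqAle p'u3.
have p'0 : 0 < p' by lra.
have [p'' st''] := chain_small _ _ _ _ _ cd _ st' p'3.
have wp'' := chain_weight _ _ _ _ _ cd _ st''.
case=> p''E.
(* Substituting [p'] cancels everything but this expression, already treated by [one_sub_q2g]. *)
- have {}p''E : p'' = 1 - q ^+ 2 * g.
    by rewrite p''E p'E gE fE uE; field; lra.
  have [p''u fu] := one_sub_q2g _ wp'' p''E.
  by apply: chain_u2_f_absurd => //; rewrite -p''u.
- have [[p'u _]|[p''u E]|[p'u p''u E]] := split_target _ _ _ _ _ _ bd wp' p'3 wp'' p''E.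
  + by move/eqP: p'u3.
  + have : q ^+ 2 * p' = p' by rewrite E p'E.
    nra.
  + have : u ^+ 4 = 2 * u ^+ 2 - u by rewrite -p'u p'E E.
    move=> h; have : (q - 1) * f = 0.
      have -> : (q - 1) * f = q ^+ 4 * (u ^+ 4 - (2 * u ^+ 2 - u)).
        by rewrite fE uE; field; lra.
      by rewrite h subrr mulr0.
    by move/eqP; rewrite mulf_eq0 subr_eq0 !gt_eqF.
Qed.
Lemma split_target_u p p' : St p -> p <= u ^+ 3 -> St p' ->
  p' = 1 - q ^+ 2 * f - q ^+ 2 * p ->
  (p' = u /\ q ^+ 2 * p = 1 - q ^+ 2 * f - u) \/
  [/\ p = u ^+ 4, p' = u ^+ 2 & 1 - q ^+ 2 * f = 2 * u ^+ 2].
Proof.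
move=> st p3 st' p'E.
have wp := chain_weight _ _ _ _ _ cd _ st.
have wp' := chain_weight _ _ _ _ _ cd _ st'.
case: (split_target _ _ _ _ _ _ bd wp p3 wp' p'E) => [[pE p'E']|?|?].
- by case: (chain_u3_absurd p'); rewrite -?pE.
- by left.
- by right.
Qed.

(** By [weight_gapM] the next weight is at least [q ^+ 3 * p], whereas [g <= p] bounds it by
    [(q ^+ 2 + 1) * p], which is smaller. *)
Lemma gapM_absurd p p' : weight q p -> weight q p' -> 0 < p ->
  g <= p -> p' = q ^+ 2 * p + g -> False.
Proof.
move=> wp wp' p0 gp p'E; have [q0 qu u0 u1] := base_u_bounds _ _ _ _ bd.
have [qlb _ _ _ _] := base_bounds _ _ _ _ bd.
case: bd => fE gE uE q1 f0 fub.
have g0 : 0 < g by rewrite gE mulr_gt0 //; nra.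
have := weight_gapM q p p' q1 wp wp' p0.
rewrite p'E ltrDl => /(_ g0) le.
have h : 1 < q ^+ 3 - q ^+ 2.
  have -> : q ^+ 3 - q ^+ 2 = q * (f + 1) by rewrite fE; ring.
  by nra.
have : 0 < (q ^+ 3 - q ^+ 2 - 1) * p by rewrite mulr_gt0; lra.
lra.
Qed.

Lemma chain_u2_absurd : St (u ^+ 2) -> False.
Proof.
move=> st; have [q0 qu u0 u1] := base_u_bounds _ _ _ _ bd.
have [qlb qub fub1 _ qqg] := base_bounds _ _ _ _ bd.
have [p' st'] := chain_u2 _ _ _ _ _ cd st.
have wp' := chain_weight _ _ _ _ _ cd _ st'.
have [fE gE uE q1 f0 fub] := bd.
have q20 := exprn_gt0 2 q0.
have q30 := exprn_gt0 3 q0.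
have q40 := exprn_gt0 4 q0.
have q50 := exprn_gt0 5 q0.
have qun n : q ^+ n * u ^+ n = 1 by rewrite -exprMn qu expr1n.
have u40 := exprn_gt0 4 u0.
have u1E : 1 - u = u ^+ 2 + u ^+ 2 * f by rewrite fE uE; field; lra.
have uf0 : 0 < u ^+ 2 * f by rewrite mulr_gt0 // exprn_gt0.
case=> p'E.
(* This weight is at least [g] and below [u ^+ 2], so [chain_small] applies to it. The first
   alternative there contradicts [gapM_absurd]; the second is an equation for [q]. *)
- have p'Ef : p' = (q ^+ 3 - q - 1) * f by rewrite p'E gE; ring.
  have c0 : q ^+ 2 - 1 < q ^+ 3 - q - 1.
    rewrite -subr_gt0.
    have -> : q ^+ 3 - q - 1 - (q ^+ 2 - 1) = q * f by rewrite fE; ring.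
    by rewrite mulr_gt0.
  have p'0 : 0 < p' by rewrite p'Ef mulr_gt0 //; nra.
  have p'2 : p' < u ^+ 2.
    rewrite -(ltr_pM2l q30).
    have -> : q ^+ 3 * u ^+ 2 = q by rewrite exprS -mulrA qun mulr1.
    have : (q ^+ 3 - q - 1) * (q ^+ 3 * f) < (q ^+ 3 - q - 1) * (q - 1).
      by rewrite ltr_pM2l //; nra.
    have -> : (q ^+ 3 - q - 1) * (q - 1) = q ^+ 2 * f + 1 by rewrite fE; ring.
    have : u * (q - 1) < 1 * (q - 1) by rewrite ltr_pM2r // subr_gt0.
    by rewrite p'Ef; lra.
  have p'3 : p' <= u ^+ 3.
    by rewrite leNgt; apply/negP => lt; apply: (gap_absurd p' 2).
  have [p'' st''] := chain_small _ _ _ _ _ cd _ st' p'3.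
  have wp'' := chain_weight _ _ _ _ _ cd _ st''.
  case=> p''E.
    apply: (gapM_absurd p' p'') => //.
    by rewrite p'Ef gE [leRHS]mulrC ler_pM2l // ltW.
  case: (split_target_u _ _ st' p'3 st'' p''E) => [[p''u E]|[p'u p''u E]].
  (* The equation determines [f], and then [p'] falls strictly between [u ^+ 5] and [u ^+ 4]. *)
  + have fq : q ^+ 4 * (q + 1) * f = 1.
      have : q * (q ^+ 2 * p') = q * (1 - q ^+ 2 * f - u) by rewrite E.
      rewrite p'Ef => h; have : (q - 1) * (q ^+ 4 * (q + 1) * f - 1) = 0.
        by move: h qu; lra.
      by move/eqP; rewrite mulf_eq0 !subr_eq0 (gt_eqF q1) => /eqP.
    have pq : q ^+ 4 * (q + 1) * p' = q ^+ 3 - q - 1.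
      by rewrite p'Ef mulrCA fq mulr1.
    apply: (gap_absurd p' 4) => //.
    * have h : 0 < f * (q ^+ 2 + q + 1) by rewrite mulr_gt0 //; nra.
      have c : 0 < q ^+ 5 * (q + 1) by rewrite mulr_gt0 //; lra.
      rewrite -(ltr_pM2l c).
      have -> : q ^+ 5 * (q + 1) * u ^+ 5 = q + 1 by rewrite mulrAC qun mul1r.
      have -> : q ^+ 5 * (q + 1) * p' = q * (q ^+ 3 - q - 1) by rewrite -pq; ring.
      by move: h; rewrite fE; lra.
    * have c : 0 < q ^+ 4 * (q + 1) by rewrite mulr_gt0 //; lra.
      rewrite -(ltr_pM2l c) pq.
      have -> : q ^+ 4 * (q + 1) * u ^+ 4 = q + 1 by rewrite mulrAC qun mul1r.
      have : q ^+ 3 < 289/100 * q by rewrite exprSr ltr_pM2r //; nra.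
      lra.
  + have : (q + 1) ^+ 2 * (q - 1) * f = 0.
      have h1 : q ^+ 2 - q ^+ 4 * f = 2.
        have -> : q ^+ 2 - q ^+ 4 * f = q ^+ 2 * (1 - q ^+ 2 * f) by ring.
        by rewrite E mulrCA qun mulr1.
      have h2 : q ^+ 4 * f * (q ^+ 3 - q - 1) = 1.
        by rewrite -[RHS](qun 4%N) -p'u p'Ef; ring.
      have h3 : q ^+ 4 * f = q ^+ 2 - 2 by lra.
      by move: h2; rewrite h3 fE => h2; lra.
    by move/eqP; rewrite !mulf_eq0 subr_eq0 !gt_eqF //; lra.
(* Now [p' > u ^+ 2], hence [p' = u] and [q ^+ 2 * g = q - 1]. The candidates following [u] are then
   [q * (2 - q)] and [2 - q], both strictly between consecutive powers of [u]. *)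
- have qgu : q * g < u - u ^+ 4.
    rewrite -(ltr_pM2l q0) mulrA mulrBr qu.
    by have -> : q * u ^+ 4 = u ^+ 3 by rewrite exprS mulrA qu mul1r.
  have p'u : p' = u.
    apply/eqP; rewrite eq_le; have := weight_le _ _ q1 wp'; rewrite -uE => ->.
    rewrite leNgt; apply/negP => lt; apply: (gap_absurd p' 1) => //; lra.
  have qqgE : q ^+ 2 * g = q - 1.
    have -> : q ^+ 2 * g = q * (1 - p') by rewrite p'E; ring.
    by rewrite p'u; lra.
  have [p'' st''] := chain_u _ _ _ _ _ cd (eq_ind _ St st' _ p'u).
  have wp'' := chain_weight _ _ _ _ _ cd _ st''.
  have q1f : 0 < (q - 1) * f by rewrite mulr_gt0 // subr_gt0.
  have h1 : u ^+ 3 < 2 - q.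
    rewrite -(ltr_pM2l q30) qun.
    have : 256 / 100 * (2 - q) <= q ^+ 2 * (2 - q) by rewrite ler_pM2r; nra.
    nra.
  have h2 : 2 - q < u ^+ 2 by rewrite -(ltr_pM2l q20) qun; move: q1f; rewrite fE; lra.
  case=> p''E; rewrite qqgE in p''E.
  + have {}p''E : p'' = q * (2 - q) by rewrite p''E fE; ring.
    have qq : u * (q * (2 - q)) = 2 - q by rewrite mulrA [u * q]mulrC qu mul1r.
    by apply: (gap_absurd p'' 1) => //; rewrite p''E -(ltr_pM2l u0) qq -exprS.
  + by apply: (gap_absurd p'' 2) => //; rewrite p''E; lra.
Qed.

(** The alternative [1 - q ^+ 2 * g] leads to [u ^+ 2], just excluded. The other lies below [u] and
    is not [u ^+ 2], so it is at most [u ^+ 3] and is treated as in [chain_u2_absurd]. *)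
Lemma chain_u_absurd : St u -> False.
Proof.
move=> st; have [q0 qu u0 u1] := base_u_bounds _ _ _ _ bd.
have [qlb qub fub1 fub2 qqg] := base_bounds _ _ _ _ bd.
have [p' st'] := chain_u _ _ _ _ _ cd st.
have wp' := chain_weight _ _ _ _ _ cd _ st'.
have [fE gE uE q1 f0 fub] := bd.
case=> p'E; last first.
  have [p'u _] := one_sub_q2g _ wp' p'E.
  by apply: chain_u2_absurd; rewrite -p'u.
have q20 := exprn_gt0 2 q0.
have q30 := exprn_gt0 3 q0.
have q50 := exprn_gt0 5 q0.
have q60 := exprn_gt0 6 q0.
have qun n : q ^+ n * u ^+ n = 1 by rewrite -exprMn qu expr1n.
have q2 : 256 / 100 < q ^+ 2 by nra.
have p'Ef : p' = (q ^+ 4 - q ^+ 2 - 1) * f by rewrite p'E gE; ring.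
have c0 : q ^+ 2 - 1 < q ^+ 4 - q ^+ 2 - 1 by nra.
have p'0 : 0 < p' by rewrite p'Ef mulr_gt0 //; lra.
have p'1 : p' < u.
  rewrite -(ltr_pM2l q30).
  have -> : q ^+ 3 * u = q ^+ 2 by rewrite exprSr -mulrA qu mulr1.
  have : (q ^+ 4 - q ^+ 2 - 1) * (q ^+ 3 * f) < (q ^+ 4 - q ^+ 2 - 1) * (q - 1).
    by rewrite ltr_pM2l //; lra.
  have -> : (q ^+ 4 - q ^+ 2 - 1) * (q - 1) = q ^+ 2 + (q ^+ 3 * f - (q - 1)).
    by rewrite fE; ring.
  by rewrite p'Ef; lra.
have [p'u2|p'u2] := eqVneq p' (u ^+ 2).
  by apply: chain_u2_absurd; rewrite -p'u2.
have p'2 : p' <= u ^+ 2.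
  by rewrite leNgt; apply/negP => lt; apply: (gap_absurd p' 1).
have p'3 : p' <= u ^+ 3.
  rewrite leNgt; apply/negP => lt; apply: (gap_absurd p' 2) => //.
  by rewrite lt_neqAle p'u2.
have [p'' st''] := chain_small _ _ _ _ _ cd _ st' p'3.
have wp'' := chain_weight _ _ _ _ _ cd _ st''.
case=> p''E.
  apply: (gapM_absurd p' p'') => //.
  by rewrite p'Ef gE [leRHS]mulrC ler_pM2l // ltW.
case: (split_target_u _ _ st' p'3 st'' p''E) => [[p''u E]|[p'u p''u E]].
+ have fq : q ^+ 5 * (q + 1) * f = 1.
    have : q * (q ^+ 2 * p') = q * (1 - q ^+ 2 * f - u) by rewrite E.
    rewrite p'Ef => h; have : (q - 1) * (q ^+ 5 * (q + 1) * f - 1) = 0.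
      by move: h qu; lra.
    by move/eqP; rewrite mulf_eq0 !subr_eq0 (gt_eqF q1) => /eqP.
  have pq : q ^+ 5 * (q + 1) * p' = q ^+ 4 - q ^+ 2 - 1.
    by rewrite p'Ef mulrCA fq mulr1.
  have c : 0 < q ^+ 5 * (q + 1) by rewrite mulr_gt0 //; lra.
  apply: (gap_absurd p' 4) => //; rewrite -(ltr_pM2l c) pq.
  * have -> : q ^+ 5 * (q + 1) * u ^+ 5 = q + 1 by rewrite mulrAC qun mul1r.
    have h : 0 < (q ^+ 2 + q) * f by rewrite mulr_gt0 //; lra.
    by move: h q2; rewrite fE; lra.
  * have -> : q ^+ 5 * (q + 1) * u ^+ 4 = q * (q + 1).
      by rewrite mulrAC [q ^+ 5]exprS -(mulrA q) qun mulr1.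
    by move: fub2; rewrite fE; lra.
(* The second factor is positive, because [q ^+ 2] exceeds 2.56 and hence 1 plus the square root of
   2. *)
+ have : (q ^+ 2 - 1) * (q ^+ 4 - 2 * q ^+ 2 - 1) = 0.
    have h1 : q ^+ 4 * f = q ^+ 2 - 2.
      have : q ^+ 2 * (1 - q ^+ 2 * f) = 2 by rewrite E mulrCA qun mulr1.
      lra.
    have h2 : q ^+ 4 * f * (q ^+ 4 - q ^+ 2 - 1) = 1.
      by rewrite -[RHS](qun 4%N) -p'u p'Ef; ring.
    by move: h2; rewrite h1 => h2; lra.
  by move/eqP; rewrite mulf_eq0 => /orP[] /eqP; nra.
Qed.

(** The second alternative of [chain_small] leads to the excluded weights [u] and [u ^+ 2]. The
    first is followed twice: [p] may be smaller than [g], but the next weight is at least [g], as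
    [gapM_absurd] requires. *)
Lemma chain_small_absurd p : St p -> p <= u ^+ 3 -> False.
Proof.
have [_ _ uE q1 _ _] := bd.
have B p1 p2 : St p1 -> p1 <= u ^+ 3 -> St p2 ->
    p2 = 1 - q ^+ 2 * f - q ^+ 2 * p1 -> False.
  move=> s1 le s2 /(split_target_u _ _ s1 le s2)[[E _]|[_ E _]].
    by apply: chain_u_absurd; rewrite -E.
  by apply: chain_u2_absurd; rewrite -E.
move=> st p3; have wp := chain_weight _ _ _ _ _ cd _ st.
have [p' st' [p'E|]] := chain_small _ _ _ _ _ cd _ st p3; last exact: B.
have wp' := chain_weight _ _ _ _ _ cd _ st'.
have p'3 : p' <= u ^+ 3.
  case/(weight_cases _ _ q1): (wp') => [->|E|E|/andP[_]].
  - by rewrite exprn_ge0 // uE invr_ge0 ltW // (lt_trans ltr01).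
  - by case: chain_u_absurd; rewrite uE -E.
  - by case: chain_u2_absurd; rewrite uE exprVn -E.
  - by rewrite uE exprVn.
have [p'' st'' [p''E|]] := chain_small _ _ _ _ _ cd _ st' p'3; last exact: B.
have wp'' := chain_weight _ _ _ _ _ cd _ st''.
have [qlb _ _ _ _] := base_bounds _ _ _ _ bd.
have [_ gE _ _ f0 _] := bd.
have g0 : 0 < g by rewrite gE mulr_gt0 //; nra.
have gp : g <= p' by rewrite p'E lerDr mulr_ge0 ?sqr_ge0 // (weight_ge0 q p).
by apply: (gapM_absurd p' p'') => //; exact: lt_le_trans g0 gp.
Qed.

Lemma chain_absurd p : St p -> False.
Proof.
have [_ _ uE q1 _ _] := bd.
move=> st; have wp := chain_weight _ _ _ _ _ cd _ st.
case/(weight_cases _ _ q1): (wp) => [E|E|E|/andP[_]].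
- apply: (chain_small_absurd p st).
  by rewrite E exprn_ge0 // uE invr_ge0 ltW // (lt_trans ltr01).
- by apply: chain_u_absurd; rewrite uE -E.
- by apply: chain_u2_absurd; rewrite uE exprVn -E.
- by rewrite -exprVn -uE; exact: chain_small_absurd.
Qed.
End Excluded.

(** * Orbits in the interval *)

Lemma expr_unbounded {R : realType} (q x : R) : 1 < q -> 0 < x ->
  exists n, 1 < q ^+ n * x.
Proof.
move=> q1 x0; have h : `|q^-1| < 1 by rewrite ger0_norm ?invr_ge0 ?invf_lt1; lra.
have /cvgr0_norm_lt/(_ x x0) := cvg_expr h.
move=> [n _ /(_ n (leqnn n))] /=.
rewrite ger0_norm ?exprn_ge0 ?invr_ge0 //; last lra.
have qn : 0 < q ^+ n by rewrite exprn_gt0; lra.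
by rewrite exprVn -(ltr_pM2l qn) divff ?gt_eqF // => ?; exists n.
Qed.

Lemma step_refl {R : realType} (q : R) c x : 1 < q ->
  step q c ((q - 1)^-1 - x) = (q - 1)^-1 - step q (~~ c) x.
Proof.
by move=> q1; rewrite /step; case: c => /=; field; lra.
Qed.

Lemma branching_refl {R : realType} (q : R) (A : set R) x : 1 < q ->
  (forall y, A y -> A ((q - 1)^-1 - y)) ->
  branching q A x -> branching q A ((q - 1)^-1 - x).
Proof.
move=> q1 Ar [n]; elim: n x => [|n IH] x.
  move=> [a0 a1]; exists 0%N.
  by split; rewrite step_refl //; [exact: (Ar _ a1) | exact: (Ar _ a0)].
move=> [c Ac /IH[m bm]]; exists m.+1; exists (~~ c); rewrite step_refl // negbK //.
exact: Ar.
Qed.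

Lemma branching_step {R : realType} (q : R) (A : set R) c x :
  A (step q c x) -> branching q A (step q c x) -> branching q A x.
Proof. by move=> Ac [n bn]; exists n.+1; exists c. Qed.

(** Here [q < M]. A point with [q * x <= 1] is multiplied by [q] until this fails, and then both
    images lie in the open interval. Points with [M <= q * x] are mirror images of such points. *)
Lemma branching_below_golden {R : realType} (q x : R) :
  1 < q -> q ^+ 2 < q + 1 -> 0 < x < (q - 1)^-1 ->
  branching q [set y | 0 < y < (q - 1)^-1] x.
Proof.
move=> q1 qG; set M := (q - 1)^-1; set A := [set y | _].
have ME : M * (q - 1) = 1 by rewrite mulVf // subr_eq0 gt_eqF.
have qM : q < M by rewrite -(@ltr_pM2r _ (q - 1)) ?ME; lra.
have low N : forall y, 0 < y -> q * y <= 1 -> 1 < q ^+ N * y -> branching q A y.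
  elim: N => [|N IH] y y0 y1; first by rewrite expr0 mul1r => ?; exfalso; nra.
  rewrite exprSr -mulrA => Ny.
  have qy0 : 0 < q * y by nra.
  have T0 : step q false y = q * y by rewrite /step subr0.
  apply: (branching_step _ _ false); rewrite T0; first by rewrite /A /=; lra.
  have [le|gt] := lerP (q * (q * y)) 1; first exact: IH.
  by exists 0%N; rewrite /= /step /A /= subr0; nra.
have low' y : 0 < y -> q * y <= 1 -> branching q A y.
  by move=> y0 y1; have [N] := expr_unbounded _ _ q1 y0; exact: low.
move=> /andP[x0 xM]; have [le|gt] := lerP (q * x) 1; first exact: low'.
have [le|lt] := lerP M (q * x).
  rewrite -[x](subKr M); apply: branching_refl => //.
    by move=> y; rewrite /A /= -/M; lra.
  by apply: low'; lra.
by exists 0%N; rewrite /= /step /A /= subr0; lra.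
Qed.

(** If the larger weight is [u], the other lies strictly between [u ^+ 3] and [u ^+ 2]; otherwise
    the sum is at most [2 * u ^+ 2 < 1 - f]. *)
Lemma weight_sum_absurd {R : realType} (q f g u p p' : R) : base_data q f g u ->
  weight q p -> weight q p' -> p + p' = 1 - f -> False.
Proof.
move=> bd; wlog le : p p' / p' <= p => [hw wp wp' E|].
  by have [le|/ltW le] := lerP p' p; [exact: (hw p p') | apply: (hw p' p) => //; lra].
have [q0 qu u0 u1] := base_u_bounds _ _ _ _ bd.
have [qlb qub fub1 _ _] := base_bounds _ _ _ _ bd.
case: bd => fE gE uE q1 f0 fub wp wp' E.
have unE n : q ^- n = u ^+ n by rewrite uE exprVn.
have q20 := exprn_gt0 2 q0.
have q30 := exprn_gt0 3 q0.
have qun n : q ^+ n * u ^+ n = 1 by rewrite -exprMn qu expr1n.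
have [pu|pu] := eqVneq p u.
  have p'3 : u ^+ 3 < p'.
    rewrite -(ltr_pM2l q30) qun.
    have -> : q ^+ 3 * p' = q ^+ 3 - q ^+ 3 * f - q ^+ 2.
      have -> : p' = 1 - f - u by lra.
      by rewrite uE; field; lra.
    have : 0 < q * f by rewrite mulr_gt0.
    by move: fub; rewrite fE; lra.
  have := weight_gap q p' 2 q1 wp'; rewrite !unE => /(_ p'3).
  have : 1 - u = u ^+ 2 + u ^+ 2 * f by rewrite fE uE; field; lra.
  have : u ^+ 2 * f < 1 * f by rewrite ltr_pM2r // expr_lt1 // ltW.
  lra.
have p2 : p <= u ^+ 2.
  rewrite leNgt; apply/negP => lt; have := weight_gap q p 1 q1 wp.
  rewrite !unE expr1 => /(_ lt) ge.
  by move: pu; rewrite eq_le ge uE weight_le.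
have : q ^+ 2 * (1 - f) <= q ^+ 2 * (2 * u ^+ 2) by rewrite ler_pM2l //; lra.
rewrite mulrCA qun; have : 256/100 < q ^+ 2 by nra.
have : 1 / 2 < u by nra.
lra.
Qed.

(** Positions are written through [b] and [f]; [q ^+ 2 * b = 1 + b] expresses that [b] and [q * b]
    form a 2-cycle. *)
Lemma base_interval {R : realType} (q f g u M b : R) : base_data q f g u ->
  M = (q - 1)^-1 -> b = (q ^+ 2 - 1)^-1 ->
  [/\ 8/5 < q, q < 17/10, 0 < f, 0 < b & b < 1] /\
  [/\ M = 1 + b * (1 - f), q ^+ 2 * b = 1 + b, q * b = 1 - f * b, f < b * (1 - f)
    & b * (1 - f) < 1].
Proof.
move=> bd ME bE.
have [qlb qub _ _ qqg] := base_bounds _ _ _ _ bd.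
have [q0 qu u0 u1] := base_u_bounds _ _ _ _ bd.
case: bd => fE gE uE q1 f0 fub.
have c0 : 0 < q ^+ 2 - 1 by nra.
have b0 : 0 < b by rewrite bE invr_gt0.
have bc : b * (q ^+ 2 - 1) = 1 by rewrite bE mulVf // gt_eqF.
have b1 : b < 1 by rewrite bE invf_lt1 //; nra.
have g0 : 0 < g by rewrite gE mulr_gt0.
have gf : g < 1 - f.
  have : 256/100 * g < q ^+ 2 * g by rewrite ltr_pM2r //; nra.
  have := exprn_gt0 3 u0.
  have : f * (156/100) <= g by rewrite gE ler_pM2l //; nra.
  lra.
do 2!split => //.
- by rewrite ME bE fE; field; rewrite !gt_eqF //; lra.
- lra.
- by rewrite bE fE; field; rewrite gt_eqF.
- rewrite -(ltr_pM2r c0) -gE [b * _]mulrC -mulrA bc; lra.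
- nra.
Qed.

(** * Points that never branch, and the chain of weights, above the golden ratio *)

Section Above.
Context {R : realType} (q f g u M b : R).
Hypothesis bd : base_data q f g u.
Hypothesis ME : M = (q - 1)^-1.
Hypothesis bE : b = (q ^+ 2 - 1)^-1.

Let I : set R := [set x | 0 <= x <= M].
Let dead x := I x /\ ~ branching q I x.

Let Ir x : I x -> I (M - x).
Proof. rewrite /I /=; lra. Qed.

Let inI x : I x <-> 0 <= x <= M. Proof. by []. Qed.

Let dead_once x : dead x -> I (step q false x) -> I (step q true x) -> False.
Proof. by move=> [_ nb] i0 i1; apply: nb; exists 0%N. Qed.

Let dead_step c x : dead x -> I (step q c x) -> dead (step q c x).
Proof.
by move=> [_ nb] Ic; split => // bc; apply: nb; exact: branching_step Ic bc.
Qed.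

Let dead_refl x : dead x -> dead (M - x).
Proof.
have q1 := base_gt1 _ _ _ _ bd.
move=> [Ix nb]; split; first exact: Ir.
move=> bx; apply: nb; rewrite -[x](subKr M) ME; apply: branching_refl => //.
  by move=> y; rewrite -ME; exact: Ir.
by rewrite -ME.
Qed.

(** The digits 0 and 1 are forced in turn; these two steps return to the same range and multiply the
    distance to the periodic point [b] by [q ^+ 2]. *)
Let dead_left n x : dead x -> M - 1 <= x -> q * x < 1 ->
  (q ^+ 2) ^+ n * `|x - b| <= 1.
Proof.
have [[qlb qub f0 b0 b1] [M1 q2b qb fb bf]] := base_interval _ _ _ _ _ _ bd ME bE.
have fE := base_f _ _ _ _ bd.
elim: n x => [|n IH] x dx xM qx.
  by rewrite expr0 mul1r ler_norml; nra.
have E0 : step q false x = q * x by rewrite /step subr0.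
have E1 : step q true (q * x) = q ^+ 2 * x - 1 by rewrite /step /=; ring.
have E2 : step q false (q * x) = q ^+ 2 * x by rewrite /step subr0; ring.
have E3 : step q false (q ^+ 2 * x - 1) = q * (q ^+ 2 * x - 1) by rewrite /step subr0.
have E4 : step q true (q ^+ 2 * x - 1) = q * (q ^+ 2 * x - 1) - 1 by rewrite /step.
have h1 : 1 <= q ^+ 2 * x.
  have : q ^+ 2 * (b * (1 - f)) <= q ^+ 2 * x by rewrite ler_pM2l; nra.
  rewrite mulrA q2b; nra.
have h2 : q ^+ 2 * x < q by nra.
have d1 : dead (q * x) by rewrite -E0; apply: dead_step => //; rewrite E0 inI; nra.
have d2 : dead (q ^+ 2 * x - 1).
  by rewrite -E1; apply: dead_step => //; rewrite E1 inI; lra.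
have h3 : M < q ^+ 2 * x.
  rewrite ltNge; apply/negP => le; apply: (dead_once _ d1).
    by rewrite E2 inI; lra.
  by rewrite E1 inI; lra.
have h4 : q * (q ^+ 2 * x - 1) < 1.
  have le : q * (q ^+ 2 * x - 1) <= q * (q - 1) by rewrite ler_pM2l; lra.
  have qq : q * (q - 1) = 1 + f by rewrite fE; ring.
  rewrite ltNge; apply/negP => ge; apply: (dead_once _ d2).
    by rewrite E3 inI; lra.
  by rewrite E4 inI; lra.
have := IH _ d2 _ h4.
have -> : q ^+ 2 * x - 1 - b = q ^+ 2 * (x - b) by lra.
rewrite normrM ger0_norm; last by nra.
by rewrite mulrA -exprSr; apply; lra.
Qed.

(** For [q * x < 1] the estimate of [dead_left], valid for all [n], leaves only [b]. The rest is the
    mirror image, with [M - b = q * b]. *)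
Let dead_mid x : dead x -> M - 1 <= x <= 1 -> x = b \/ x = q * b.
Proof.
have [[qlb qub f0 b0 b1] [M1 q2b qb fb bf]] := base_interval _ _ _ _ _ _ bd ME bE.
have left y : dead y -> M - 1 <= y -> q * y < 1 -> y = b.
  move=> dy yM qy; apply/eqP; rewrite -subr_eq0 -normr_le0 leNgt; apply/negP => y0.
  have q21 : 1 < q ^+ 2 by nra.
  have [n] := expr_unbounded _ _ q21 y0.
  by rewrite ltNge dead_left.
move=> dx /andP[xM x1]; have [lt|ge] := ltrP (q * x) 1; first by left; exact: left.
right; have E0 : step q false x = q * x by rewrite /step subr0.
have E1 : step q true x = q * x - 1 by rewrite /step.
have gt : M < q * x.
  rewrite ltNge; apply/negP => le; apply: (dead_once _ dx).
    by rewrite E0 inI; lra.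
  by rewrite E1 inI; lra.
have qM : q * M = M + 1.
  by rewrite ME; field; rewrite subr_eq0 gt_eqF; lra.
have : M - x = b by apply: left; [exact: dead_refl | lra | lra].
lra.
Qed.

(** Below [M - 1], multiplication by [q] stays at most 1, so the orbit enters the range of
    [dead_mid]. *)
Let dead_low N x : dead x -> 0 < x <= 1 -> 1 < q ^+ N * x ->
  x = q * b \/ exists k, x = q ^- k * b.
Proof.
have [[qlb qub f0 b0 b1] [M1 q2b qb fb bf]] := base_interval _ _ _ _ _ _ bd ME bE.
elim: N x => [|N IH] x dx /andP[x0 x1]; first by rewrite expr0; lra.
rewrite exprSr -mulrA => Nx.
have [ge|lt] := lerP (M - 1) x.
  have xr : M - 1 <= x <= 1 by rewrite ge.
  have [->|->] := dead_mid _ dx xr.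
    by right; exists 0%N; rewrite expr0 invr1 mul1r.
  by left.
have E0 : step q false x = q * x by rewrite /step subr0.
have le : q * x <= 1.
  have : q * x < q * (b * (1 - f)) by rewrite ltr_pM2l; lra.
  rewrite mulrA qb; nra.
have qx0 : 0 < q * x by rewrite mulr_gt0; lra.
have qn0 : q != 0 by rewrite gt_eqF; lra.
have dq : dead (q * x).
  by rewrite -E0; apply: dead_step => //; rewrite E0 inI; nra.
have qxr : 0 < q * x <= 1 by rewrite qx0.
right; case: (IH _ dq qxr Nx) => [|[k]].
- by move/(mulfI qn0) => ->; exists 0%N; rewrite expr0 invr1 mul1r.
- move=> E; exists k.+1; apply: (mulfI qn0).
  by rewrite E exprS invfM !mulrA divff // mul1r.
Qed.

(** Both points of the 2-cycle exceed [M - 1 = b * (1 - f)], which removes them from the list of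
    [dead_low]. *)
Let dead_bottom x : dead x -> x <= M - 1 -> exists2 p, weight q p & x = p * b.
Proof.
have [[qlb qub f0 b0 b1] [M1 q2b qb fb bf]] := base_interval _ _ _ _ _ _ bd ME bE.
have q1 : 1 < q by lra.
move=> dx xM; have [] := dx; rewrite inI le_eqVlt => /andP[/orP[/eqP<- _ _|x0 _ _]].
  by exists 0; [left | rewrite mul0r].
have [N Nx] := expr_unbounded _ _ q1 x0.
have xr : 0 < x <= 1 by rewrite x0; lra.
case: (dead_low _ _ dx xr Nx).
  by nra.
move=> [[|k] xE]; last by exists (q ^- k.+1) => //; right; exists k.
by move: xE; rewrite expr0 invr1 mul1r; nra.
Qed.

(** The mirror image would be some [p' * b] with [p + p' = 1 - f]. *)
Let dead_middle p : weight q p -> dead (1 + p * b) -> False.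
Proof.
have [[qlb qub f0 b0 b1] [M1 q2b qb fb bf]] := base_interval _ _ _ _ _ _ bd ME bE.
have q1 : 1 < q by lra.
move=> wp d; have p0 := weight_ge0 _ _ q1 wp.
have [|p' wp' E] := dead_bottom _ (dead_refl _ d); first by nra.
apply: (weight_sum_absurd _ _ _ _ p p' bd wp wp').
by apply: (mulIf (lt0r_neq0 b0)); lra.
Qed.

(* C will be the set of the points of A at which A fails to branch, made
   symmetric under x |-> M - x. *)
Variable C : set R.
Hypothesis C_refl : forall x, C x -> C (M - x).
Hypothesis C_alive : forall x, C x -> I x /\ branching q I x.
Hypothesis C_step : forall c x, C x -> I (step q c x) -> branching q I (step q c x) ->
  C (step q c x).
Hypothesis C_once : forall x, C x -> C (step q false x) -> C (step q true x) -> False.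

Let state p := weight q p /\ C (1 + p * b).

(** The lower image is dead, hence some [p * b]; the upper one is [1 + p * b], alive by
    [dead_middle], so it stays in [C]. *)
Let split_true x : C x -> I (step q false x) -> I (step q true x) ->
  ~ branching q I (step q true x) ->
  exists2 p, state p & step q true x = p * b.
Proof.
have [[qlb qub f0 b0 b1] [M1 q2b qb fb bf]] := base_interval _ _ _ _ _ _ bd ME bE.
have q1 : 1 < q by lra.
move=> Cx I0 I1 nb.
have E : step q false x = 1 + step q true x by rewrite /step /=; ring.
have [p wp pE] : exists2 p, weight q p & step q true x = p * b.
  by apply: dead_bottom; [split | move: I0; rewrite E inI; lra].
exists p => //; split => //; rewrite -pE -E; apply: C_step => //.
by apply: contrapT => nb0; apply: (dead_middle _ wp); rewrite -pE -E; split.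
Qed.

(** By [C_once] one of the images is dead; if it is the upper one, reflection reduces to
    [split_true]. *)
Let split_state x : C x -> I (step q false x) -> I (step q true x) ->
  exists2 p, state p & step q true x = p * b \/ step q false x = M - p * b.
Proof.
have [[qlb qub f0 b0 b1] [M1 q2b qb fb bf]] := base_interval _ _ _ _ _ _ bd ME bE.
have q1 : 1 < q by lra.
move=> Cx I0 I1.
have [b1'|nb1] := pselect (branching q I (step q true x)); last first.
  by have [p st E] := split_true _ Cx I0 I1 nb1; exists p => //; left.
have Rf c : step q c (M - x) = M - step q (~~ c) x by rewrite ME step_refl.
have J0 : I (step q false (M - x)) by rewrite Rf; exact: (Ir _ I1).
have J1 : I (step q true (M - x)) by rewrite Rf; exact: (Ir _ I0).
have nb0 : ~ branching q I (step q true (M - x)).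
  rewrite Rf => b0'; apply: (C_once _ Cx); apply: C_step => //.
  rewrite -[step _ _ _](subKr M) ME; by apply: branching_refl => //; rewrite -ME.
have [p st E] := split_true _ (C_refl _ Cx) J0 J1 nb0.
by exists p => //; right; move: E; rewrite Rf /= => E; lra.
Qed.

Let forced x : C x -> M < q * x -> C (q * x - 1).
Proof.
move=> Cx lt; have E : step q true x = q * x - 1 by [].
have [_ [[|n]]] := C_alive _ Cx; first by rewrite /= inI /step subr0; lra.
move=> [[] Ic bc]; last by move: Ic; rewrite inI /step subr0; lra.
by rewrite -E; apply: C_step => //; exists n.
Qed.

(** From [1 + p * b] the digit 1 is forced until both images lie in [I]: one step for [p <= u ^+ 3],
    three for [u], two for [u ^+ 2]. Dividing the outcome of [split_state] by [b], with [g * b = f],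
    gives the two formulas. *)
Lemma state_chain : chain_data q f g u state.
Proof.
have [[qlb qub f0 b0 b1] [M1 q2b qb fb bf]] := base_interval _ _ _ _ _ _ bd ME bE.
have [q0 qu u0 u1] := base_u_bounds _ _ _ _ bd.
have [_ _ fub1 fub2 qqg] := base_bounds _ _ _ _ bd.
have [fE gE uE q1 _ fub] := bd.
have gb : g * b = f by rewrite gE bE -mulrA divff ?mulr1 // gt_eqF; nra.
have u30 := exprn_gt0 3 u0.
have E0 x : step q false x = q * x by rewrite /step subr0.
have E1 x : step q true x = q * x - 1 by [].
split; first by move=> p [].
- move=> p [wp Cp] p3.
  have p0 := weight_ge0 _ _ q1 wp.
  have pb0 : 0 <= p * b by rewrite mulr_ge0 // ltW.
  have Cz : C (q - 1 + q * p * b).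
    have -> : q - 1 + q * p * b = q * (1 + p * b) - 1 by ring.
    by apply: forced => //; nra.
  have Z0 : step q false (q - 1 + q * p * b) = 1 + f + q ^+ 2 * p * b.
    by rewrite E0 fE; ring.
  have Z1 : step q true (q - 1 + q * p * b) = f + q ^+ 2 * p * b.
    by rewrite E1 fE; ring.
  have q2p : q ^+ 2 * p * b <= b * (1 - q ^+ 2 * f).
    have : q ^+ 2 * p <= u.
      have -> : u = q ^+ 2 * u ^+ 3 by rewrite uE; field; lra.
      by rewrite ler_pM2l // exprn_gt0.
    by move=> h; rewrite mulrC ler_pM2l //; lra.
  have q2fb : b * (q ^+ 2 * f) = f + f * b by rewrite mulrA [b * _]mulrC q2b; ring.
  have q2p0 : 0 <= q ^+ 2 * p * b by rewrite -mulrA mulr_ge0 // exprn_ge0 // ltW.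
  have [||p' st E] := split_state _ Cz; rewrite ?Z0 ?Z1 ?inI; [lra|lra|].
  exists p' => //; case: E => E; [left|right]; apply: (mulIf (lt0r_neq0 b0)).
    by move: E; rewrite Z1 => E; lra.
  by move: E; rewrite Z0 => E; lra.
- move=> [_ Cp].
  have C1 : C (q - 1 + b).
    have -> : q - 1 + b = q * (1 + u * b) - 1 by rewrite mulrDr mulrA qu; ring.
    by apply: forced => //; rewrite mulrDr mulrA qu; nra.
  have C2 : C (f + q * b).
    have -> : f + q * b = q * (q - 1 + b) - 1 by rewrite fE; ring.
    apply: forced => //; have -> : q * (q - 1 + b) = 1 + f + q * b by rewrite fE; ring.
    by nra.
  have Cz : C (q * f + b).
    have -> : q * f + b = q * (f + q * b) - 1.
      have -> : q * (f + q * b) = q * f + q ^+ 2 * b by ring.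
      by rewrite q2b; ring.
    apply: forced => //; have -> : q * (f + q * b) = q * f + q ^+ 2 * b by ring.
    by rewrite q2b; nra.
  have Z0 : step q false (q * f + b) = q ^+ 2 * f + q * b by rewrite E0; ring.
  have Z1 : step q true (q * f + b) = q ^+ 2 * f + q * b - 1 by rewrite E1; ring.
  have h1 : q ^+ 2 * f <= b.
    have : (q ^+ 2 * g) * b <= 1 * b by rewrite ler_pM2r //; lra.
    by rewrite -mulrA gb; lra.
  have h2 : f * b <= q ^+ 2 * f by rewrite mulrC ler_pM2r //; nra.
  have [||p' st E] := split_state _ Cz; rewrite ?Z0 ?Z1 ?inI; [lra|lra|].
  exists p' => //; case: E => E; [left|right]; apply: (mulIf (lt0r_neq0 b0)).
    by move: E; rewrite Z1 => E; rewrite mulrBl -mulrA gb; lra.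
  by move: E; rewrite Z0 => E; rewrite mulrBl -mulrA gb; lra.
- move=> [_ Cp].
  have qu2 : q * (u ^+ 2 * b) = u * b by rewrite expr2 !mulrA qu mul1r.
  have C1 : C (q - 1 + u * b).
    have -> : q - 1 + u * b = q * (1 + u ^+ 2 * b) - 1 by rewrite mulrDr qu2; ring.
    by apply: forced => //; rewrite mulrDr qu2; nra.
  have Cz : C (f + b).
    have E : q * (q - 1 + u * b) = 1 + f + b by rewrite mulrDr mulrA qu fE; ring.
    have -> : f + b = q * (q - 1 + u * b) - 1 by rewrite E; ring.
    by apply: forced => //; rewrite E; nra.
  have Z0 : step q false (f + b) = q * f + q * b by rewrite E0; ring.
  have Z1 : step q true (f + b) = q * f + q * b - 1 by rewrite E1; ring.
  have h1 : q * f <= b.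
    have : (q * g) * b <= 1 * b.
      rewrite ler_pM2r //; have g0 : 0 < g by rewrite gE mulr_gt0 //; nra.
      have : q * g < q ^+ 2 * g by rewrite ltr_pM2r //; nra.
      lra.
    by rewrite -mulrA gb; lra.
  have h2 : f * b <= q * f by rewrite mulrC ler_pM2r //; nra.
  have [||p' st E] := split_state _ Cz; rewrite ?Z0 ?Z1 ?inI; [lra|lra|].
  exists p' => //; case: E => E; [left|right]; apply: (mulIf (lt0r_neq0 b0)).
    by move: E; rewrite Z1 => E; rewrite mulrBl -mulrA gb; lra.
  by move: E; rewrite Z0 => E; rewrite mulrBl -mulrA gb; lra.
Qed.

(** A nonzero weight is wanted in order to recover [b] from [1 + p * b]. The weight 0 is followed by
    [g] or [1 - q ^+ 2 * f], both positive. *)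
Lemma state_exists x : C x -> exists p, [/\ weight q p, p != 0 & C (1 + p * b)].
Proof.
have [[qlb qub f0 b0 b1] _] := base_interval _ _ _ _ _ _ bd ME bE.
have [q0 qu u0 u1] := base_u_bounds _ _ _ _ bd.
have [_ _ fub1 _ _] := base_bounds _ _ _ _ bd.
have [fE gE uE q1 _ fub] := bd.
move=> Cx; have [p st] : exists p, state p.
  have [_ [n]] := C_alive _ Cx; elim: n x Cx => [|n IH] x Cx.
    by move=> [i0 i1]; have [p st _] := split_state _ Cx i0 i1; exists p.
  by move=> [c Ic bc]; apply: (IH (step q c x)) => //; apply: C_step => //; exists n.
have [p0|] := eqVneq p 0; last by exists p; case: st.
have [|p' [wp' Cp']] := chain_small _ _ _ _ _ state_chain _ st.
  by rewrite p0 exprn_ge0 // ltW.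
rewrite p0 mulr0 add0r subr0 => pE; exists p'; split => //.
case: pE => ->; rewrite gt_eqF //; last lra.
by rewrite gE mulr_gt0 //; nra.
Qed.

End Above.

(** * Integrality *)

Definition parity (x : int) : bool := (x%:~R : 'Z_2) != 0.

Lemma parityD x y : parity (x + y) = parity x (+) parity y.
Proof.
rewrite /parity intrD; move: (x%:~R) (y%:~R) => a b.
by case: a => [[|[|//]] ?]; case: b => [[|[|//]] ?].
Qed.

Lemma parityM x y : parity (x * y) = parity x && parity y.
Proof.
rewrite /parity intrM; move: (x%:~R) (y%:~R) => a b.
by case: a => [[|[|//]] ?]; case: b => [[|[|//]] ?].
Qed.

Lemma parity_sum n (F : 'I_n -> int) :
  parity (\sum_(i < n) F i) = \big[addb/false]_(i < n) parity (F i).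
Proof. by apply: (big_morph _ parityD); rewrite /parity rmorph0 eqxx. Qed.

Lemma parity0 : parity 0 = false.
Proof. by rewrite /parity rmorph0 eqxx. Qed.

(* Coefficients modulo 2, constant term first, of the sextics of
   sextics_excluded: both are irreducible modulo 2. *)
Definition sextic_parities : seq bitseq :=
  [:: [:: true; true; false; true; true; false; true; false; false];
      [:: true; false; false; true; false; false; true; false; false]].

(** The nine entries are the coefficients of a product modulo 2 of factors of degrees at most 3 and
    5; all cases are checked. *)
Lemma sextic_parities_mul (c0 c1 c2 c3 e0 e1 e2 e3 e4 e5 : bool) :
  [:: c0 && e0; c0 && e1 (+) c1 && e0; c0 && e2 (+) (c1 && e1 (+) c2 && e0);
      c0 && e3 (+) (c1 && e2 (+) (c2 && e1 (+) c3 && e0));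
      c0 && e4 (+) (c1 && e3 (+) (c2 && e2 (+) c3 && e1));
      c0 && e5 (+) (c1 && e4 (+) (c2 && e3 (+) c3 && e2));
      c1 && e5 (+) (c2 && e4 (+) c3 && e3); c2 && e5 (+) c3 && e4; c3 && e5]
    \in sextic_parities ->
  ~~ [|| c1, c2 | c3].
Proof.
by move: c0 c1 c2 c3 e0 e1 e2 e3 e4 e5; do 10 case.
Qed.

Lemma sextic_factor (c e : {poly int}) :
  (size c <= 4)%N -> (size e <= 6)%N ->
  mkseq (fun i => parity (c * e)`_i) 9 \in sextic_parities ->
  ~~ [|| parity c`_1, parity c`_2 | parity c`_3].
Proof.
move=> sc se.
have c0 i : c`_(4 + i) = 0 by rewrite nth_default // (leq_trans sc) // leq_addr.
have e0 i : e`_(6 + i) = 0 by rewrite nth_default // (leq_trans se) // leq_addr.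
rewrite /mkseq /= !coefM !parity_sum !big_ord_recl !big_ord0 /= /bump /=.
rewrite !parityM.
have [c4 c5 c6] : [/\ c`_4 = 0, c`_5 = 0 & c`_6 = 0] by split; apply: (c0 _).
have [c7 c8] : c`_7 = 0 /\ c`_8 = 0 by split; apply: (c0 _).
have [e6 e7 e8] : [/\ e`_6 = 0, e`_7 = 0 & e`_8 = 0] by split; apply: (e0 _).
rewrite c4 c5 c6 c7 c8 e6 e7 e8 parity0 !(andbF, addbF, andFb, addFb) => h.
exact: sextic_parities_mul h.
Qed.

(** Both factors have odd leading coefficients and their degrees add up to 6, so a proper factor of
    degree at most 3 would stay nonconstant modulo 2. *)
Lemma monic_sextic_irreducible (m : {poly int}) : m \is monic -> size m = 7%N ->
  mkseq (fun i => parity m`_i) 9 \in sextic_parities -> irreducible_poly m.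
Proof.
move=> mm sm pm; split; first by rewrite sm.
move=> d sd dm; have [c [r mE sc]] : exists c, exists2 r, m = c * r & size c = size d.
  have [r mE] := dvdpP_int dm.
  by exists (zprimitive d), r => //; exact: size_zprimitive.
have lc : lead_coef c * lead_coef r = 1 by rewrite -lead_coefM -mE (monicP mm).
have pc : parity (lead_coef c) && parity (lead_coef r) by rewrite -parityM lc.
have c0 : c != 0 by apply: contraTneq pc => ->; rewrite lead_coef0 parity0.
have r0 : r != 0 by apply: contraTneq pc => ->; rewrite lead_coef0 parity0 andbF.
have cr : (size c + size r = 8)%N.
  by have := size_mul c0 r0; rewrite -mE sm; case: (size c + size r)%N => [|k] //= <-.
have small (a e : {poly int}) : parity (lead_coef a) -> (1 < size a <= 4)%N ->
    (size a + size e = 8)%N -> m = a * e -> False.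
  move=> pa /andP[a1 a4] ae E.
  have e6 : (size e <= 6)%N by lia.
  have := sextic_factor _ _ a4 e6; rewrite -E => /(_ pm); rewrite !negb_or.
  move: pa a1 a4; rewrite lead_coefE.
  by case: (size a) => [|[|[|[|[|k]]]]] //= -> _ _; rewrite ?andbF.
have s1 : (1 < size c)%N.
  by rewrite sc; move: sd c0; rewrite -size_poly_gt0 sc; case: (size d) => [|[|]].
case/andP: pc => pc pr.
have s4 : (4 < size c)%N.
  by rewrite ltnNge; apply/negP => le; apply: (small c r); rewrite ?s1.
have r1 : (size r <= 1)%N.
  rewrite leqNgt; apply/negP => lt; apply: (small r c) => //.
  - by rewrite lt; move: cr s4; move: (size c) (size r) => a b; lia.
  - by rewrite addnC.
  - by rewrite mulrC.
rewrite -dvdp_size_eqp // -sc; move: r0; rewrite -size_poly_gt0 => r0.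
by apply/eqP; rewrite sm; move: cr r1 r0; move: (size c) (size r) => a b; lia.
Qed.

Definition poly_value {R : realType} (q x : R) : Prop :=
  exists P : {poly int}, x = (map_poly intr P).[q].

(** A common real root prevents coprimality over the rationals, so [m] divides [N]; as [m] is monic,
    the quotient is integral and can be evaluated at 1. *)
Lemma root_irreducible_dvd {R : realType} (q : R) (m N : {poly int}) :
  m \is monic -> irreducible_poly m ->
  (map_poly intr m).[q] = 0 -> (map_poly intr N).[q] = 0 ->
  (m.[1] %| N.[1])%Z.
Proof.
move=> mm mi mq Nq.
have toR (P : {poly int}) :
    map_poly intr P = map_poly ratr (map_poly intr P : {poly rat}) :> {poly R}.
  by rewrite -map_poly_comp; apply: eq_map_poly => z /=; rewrite ratr_int.
have : m %| N.
  rewrite -dvdp_rat_int -[_ %| _]negbK -irreducible_poly_coprime; last first.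
    exact/irreducible_rat_int.
  apply/negP; rewrite -(coprimep_map (ratr : {rmorphism rat -> R})) -!toR.
  by move/coprimep_root => /(_ q); rewrite /root mq Nq eqxx => /(_ isT).
by move=> /dvdpP_int[r ->]; rewrite zprimitive_monic // hornerM dvdz_mulr.
Qed.

Lemma sextics_excluded {R : realType} (q : R) : 1 < q ->
  poly_value q (q ^+ 2 - 1)^-1 ->
  q ^+ 6 - q ^+ 4 - q ^+ 3 - 2 * q ^+ 2 - q - 1 != 0 /\
  q ^+ 6 - 2 * q ^+ 4 - q ^+ 3 - 1 != 0.
Proof.
move=> q1 [P PE]; have q2 : q ^+ 2 - 1 != 0 by rewrite gt_eqF //; nra.
pose N : {poly int} := ('X^2 - 1) * P - 1.
have Nq : (map_poly intr N).[q] = 0.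
  rewrite /N !(rmorphB, rmorphM, rmorph1) /= ?map_polyXn ?map_polyX !hornerE -PE.
  by rewrite mulfV ?subrr.
have N1 : N.[1] = -1 by rewrite /N !hornerE ?subrr ?mul0r ?sub0r.
(* The list [s] holds the coefficients, constant term first, and [horner_rec s 1] is the value of
   the sextic at 1. *)
have excl (s : seq int) : size s = 7%N -> last 1 s = 1 ->
    mkseq (fun i => parity s`_i) 9 \in sextic_parities ->
    ~~ (horner_rec s 1 %| - 1)%Z ->
    horner_rec [seq z%:~R | z <- s] q != 0.
  move=> ss s6 sp; apply: contraNneq => s0.
  have sE : Poly s = s :> seq int by rewrite (@PolyK _ 1) // s6.
  suff : (horner_rec s 1 %| N.[1])%Z by rewrite N1.
  have sm : Poly s \is monic.
    rewrite monicE lead_coefE sE nth_last; move: ss s6.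
    by case: (s) => [//|a l] _ /= ->.
  rewrite -horner_Poly; apply: (root_irreducible_dvd q) => //.
  - by apply: monic_sextic_irreducible => //; rewrite sE.
  - by rewrite map_Poly // horner_Poly.
split.
- have := excl [:: -1; -1; -2; -1; -1; 0; 1] erefl erefl erefl erefl.
  by apply: contraNneq => /= E; lra.
- have := excl [:: -1; 0; 0; -1; -2; 0; 1] erefl erefl erefl erefl.
  by apply: contraNneq => /= E; lra.
Qed.

(** Otherwise the quintic defining [q3] is nonnegative at [q] and negative at 1, so its unique root
    would be at most [q]. *)
Lemma below_q3 {R : realType} (q : R) : 1 < q < q3 R ->
  q ^+ 3 * (q ^+ 2 - q - 1) < q - 1.
Proof.
move=> /andP[q1 qlt]; rewrite ltNge; apply/negP => ge.
have q32 : q3 R < 2.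
  have : [set q3 R] (q3 R) by [].
  by rewrite -q3_rootsE => -[/andP[]].
pose p : {poly R} := 'X^5 - 'X^4 - 'X^3 - 'X + 1.
have pE x : p.[x] = x ^+ 5 - x ^+ 4 - x ^+ 3 - x + 1 by rewrite /p !hornerE.
have [||x /andP[x1 xq]] := @poly_ivt R p 1 q; first exact: ltW.
  by rewrite !pE; apply/andP; split; lra.
rewrite /root pE => /eqP px.
have : q3_roots x.
  split => //; apply/andP; split; last lra.
  rewrite lt_neqAle x1 andbT; apply/eqP => xE; move: px; rewrite -xE; lra.
by rewrite q3_rootsE /= => xE; move: xq; rewrite xE leNgt qlt.
Qed.

Lemma golden_quadratic {R : realType} (q : R) :
  1 < q -> q ^+ 2 = q + 1 -> q = golden_ratio R.
Proof.
move=> q1 qE; have -> : golden_ratio R = (1 + Num.sqrt ((2 * q - 1) ^+ 2)) / 2.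
  by rewrite /golden_ratio; congr ((1 + Num.sqrt _) / 2); lra.
by rewrite sqrtr_sqr ger0_norm; lra.
Qed.

(** * The ring Z[q] and the conclusion *)

Section PolyValue.
Context {R : realType} (q : R).

Lemma poly_valueB x y : poly_value q x -> poly_value q y -> poly_value q (x - y).
Proof. by move=> [P ->] [Q ->]; exists (P - Q); rewrite rmorphB !hornerE. Qed.

Lemma poly_valueM x y : poly_value q x -> poly_value q y -> poly_value q (x * y).
Proof. by move=> [P ->] [Q ->]; exists (P * Q); rewrite rmorphM !hornerE. Qed.

Lemma poly_value_nat n : poly_value q n%:R.
Proof. by exists n%:R; rewrite rmorph_nat hornerMn hornerC. Qed.

Lemma poly_value_base : poly_value q q.
Proof. by exists 'X; rewrite map_polyX hornerX. Qed.

Lemma poly_value_exp n : poly_value q (q ^+ n).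
Proof.
elim: n => [|n IH]; first exact: (poly_value_nat 1).
by rewrite exprS; apply: poly_valueM => //; exact: poly_value_base.
Qed.

Lemma poly_value_step c x : poly_value q x -> poly_value q (step q c x).
Proof.
move=> Px; apply: poly_valueB; last exact: poly_value_nat.
by apply: poly_valueM => //; exact: poly_value_base.
Qed.

Lemma poly_value_tail p b M : b * (q ^+ 2 - 1) = 1 -> M = (q + 1) * b ->
  1 < q -> weight q p -> p != 0 ->
  poly_value q (1 + p * b) \/ poly_value q (M - (1 + p * b)) -> poly_value q b.
Proof.
move=> bE ME q1; have q0 : q != 0 by rewrite gt_eqF //; lra.
case=> [->|[k pE] _]; first by rewrite eqxx.
have one : poly_value q 1 := poly_value_nat 1.
have bE' : b = q ^+ k.+1 * (p * b).
  by rewrite mulrA pE divff ?mul1r // expf_neq0.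
have Pq := poly_value_exp k.+1.
case=> H.
  rewrite bE'; apply: poly_valueM => //.
  by have -> : p * b = 1 + p * b - 1 by [ring]; exact: poly_valueB.
(* Although [M] need not be in Z[q], these differences are, because [q * M = M + 1]. *)
have geo n : poly_value q (q ^+ n * M - M).
  elim: n => [|n IH]; first by rewrite mul1r subrr; exact: (poly_value_nat 0).
  have -> : q ^+ n.+1 * M - M = q * (q ^+ n * M - M) - (0 - 1).
    by rewrite exprS ME; lra.
  apply: poly_valueB; first by apply: poly_valueM => //; exact: poly_value_base.
  by apply: poly_valueB => //; exact: (poly_value_nat 0).
(* The combination below equals [M - b]. *)
have a : poly_value q (q * b).
  have -> : q * b =
      q ^+ k.+1 * (M - (1 + p * b)) - (0 - q ^+ k.+1) - (q ^+ k.+1 * M - M).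
    have : q ^+ k.+1 * (p * b) = b by rewrite -bE'.
    by move: (q ^+ k.+1) => z; rewrite ME; lra.
  apply: poly_valueB => //; apply: poly_valueB; first exact: poly_valueM.
  by apply: poly_valueB => //; exact: (poly_value_nat 0).
have -> : b = q * (q * b) - 1 by lra.
by apply: poly_valueB => //; apply: poly_valueM => //; exact: poly_value_base.
Qed.
End PolyValue.

Lemma branching_above_golden {R : realType} (q f g u : R) : base_data q f g u ->
  let I := [set x | 0 <= x <= (q - 1)^-1] in
  let A := [set x | [/\ poly_value q x, I x & branching q I x]] in
  forall x, A x -> branching q A x.
Proof.
move=> bd I A x Ax; apply: contrapT => nb.
pose M := (q - 1)^-1; pose b := (q ^+ 2 - 1)^-1.
have q1 := base_gt1 _ _ _ _ bd.
have Ir y : I y -> I (M - y) by rewrite /I /M /=; lra.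
have br y : branching q I y -> branching q I (M - y).
  by move=> h; apply: branching_refl.
pose C0 := [set y | A y /\ ~ branching q A y].
(* The set [A] need not be symmetric, since [M] may lie outside Z[q]. *)
pose C := [set y | C0 y \/ C0 (M - y)].
have C0_step c y : C0 y -> I (step q c y) -> branching q I (step q c y) ->
    C0 (step q c y).
  move=> [[Py _ _] nby] Ic bc; have Ac : A (step q c y).
    by split => //; exact: poly_value_step.
  by split => // bAc; apply: nby; exact: branching_step Ac bAc.
have Rf c y : step q c (M - y) = M - step q (~~ c) y by rewrite step_refl.
have C_refl y : C y -> C (M - y) by rewrite /C /= subKr => -[]; [right|left].
have C_alive y : C y -> I y /\ branching q I y.
  case=> [[[_ Iy By] _]//|[[_ Iy By] _]].
  by rewrite -[y](subKr M); split; [exact: Ir | exact: br].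
have C_step c y : C y -> I (step q c y) -> branching q I (step q c y) ->
    C (step q c y).
  case=> Cy Ic bc; [left; exact: C0_step|right].
  have E : M - step q c y = step q (~~ c) (M - y) by rewrite Rf negbK.
  by rewrite E; apply: C0_step => //; rewrite -E; [exact: Ir | exact: br].
have C0_once y : C0 y -> C (step q false y) -> C (step q true y) -> False.
  move=> [[Py _ _] nby] /C_alive[I0 b0] /C_alive[I1 b1]; apply: nby.
  by exists 0%N; split; split => //; exact: poly_value_step.
have C_once y : C y -> C (step q false y) -> C (step q true y) -> False.
  case=> Cy c0 c1; first exact: (C0_once _ Cy).
  by apply: (C0_once _ Cy); rewrite Rf; exact: C_refl.
have Cx : C x by left.
have [p [wp p0 Cp]] :=
  state_exists q f g u M b bd erefl erefl C C_refl C_alive C_step C_once x Cx.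
have [[qlb qub f0 b0 b1] [M1 q2b qb fb bf]] := base_interval _ _ _ _ M b bd erefl erefl.
have [n1 n2] : q ^+ 6 - q ^+ 4 - q ^+ 3 - 2 * q ^+ 2 - q - 1 != 0 /\
    q ^+ 6 - 2 * q ^+ 4 - q ^+ 3 - 1 != 0.
  apply: sextics_excluded => //; apply: (poly_value_tail q p b M) => //.
  - lra.
  - by rewrite M1; lra.
  - by case: Cp => [[[Pp _ _] _]|[[Pp _ _] _]]; [left|right].
have chain := state_chain q f g u M b bd erefl erefl C C_refl C_alive C_step C_once.
exact: (chain_absurd q f g u _ bd chain n1 n2 p (conj wp Cp)).
Qed.

Theorem corollary1p3 (R : realType) (q : R) (hq : 1 < q < q3 R)
    (hq_golden : q <> golden_ratio R) :
  [set d : nat -> bool | q_expansion q 1 d] #= [set: nat -> bool].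
Proof.
have /andP[q1 _] := hq; have lt := below_q3 q hq.
have ME : (q - 1)^-1 * (q - 1) = 1 by rewrite mulVf // subr_eq0 gt_eqF.
have [G|G|/(golden_quadratic q q1)//] := ltgtP (q ^+ 2) (q + 1).
  apply: (branching_continuum q [set x | 0 < x < (q - 1)^-1] (q - 1)^-1) => //.
  - by move=> x /= /andP[x0 xM]; rewrite ger0_norm ltW.
  - by move=> x; exact: branching_below_golden.
  - by rewrite /= ltr01 invf_gt1 ?subr_gt0 //; nra.
have bd : base_data q (q ^+ 2 - q - 1) ((q ^+ 2 - q - 1) * (q ^+ 2 - 1)) q^-1.
  by split => //; lra.
apply: (branching_continuum q _ (q - 1)^-1 q1 _ (branching_above_golden _ _ _ _ bd)).
  by move=> x [_ /andP[x0 xM] _]; rewrite ger0_norm.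
have [[_ qub _ _ _] [M1 _ _ fb bf]] := base_interval _ _ _ _ _ _ bd erefl erefl.
set f := q ^+ 2 - q - 1 in M1 fb bf.
have f0 : 0 < f by rewrite /f; lra.
have qq : q * (q - 1) = 1 + f by rewrite /f; ring.
split; first exact: (poly_value_nat q 1).
  by rewrite /= M1 ler01 /=; lra.
(* The digit 1 takes 1 to [q - 1], whose images [1 + f] and [f] both lie in the interval. *)
apply: (branching_step _ _ true).
  by rewrite /step /= mulr1 M1; lra.
exists 0%N; rewrite /= /step /= mulr1 subr0 qq M1; lra.
Qed.
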